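(* Let $X\subset\mathbb R^{2n}$ be a centrally symmetric convex body such that $X^\omega\subseteq X$. Then $$c_{EHZ}(X)\ge 2+\frac1n.$$
   Context: A convex body is a compact convex set with nonempty interior; it is centrally symmetric if $X=-X$. Let $\omega$ be the standard symplectic form on $\mathbb R^{2n}\cong\mathbb C^n$ and $J$ the multiplication by $\sqrt{-1}$, so that $\omega(x,y)=Jx\cdot y$. The symplectic polar of a convex body $X$ with the origin in its interior is $X^\omega=\{y\in\mathbb R^{2n} : \omega(x,y)\le 1\ \forall x\in X\}$. The Ekeland--Hofer--Zehnder capacity $c_{EHZ}$ of a convex body $X\subset\mathbb R^{2n}$: if $X$ has smooth boundary and the origin in its interior, with gauge function $g_X$ (so $X=\{g_X\le 1\}$), a closed characteristic is a closed curve $\gamma:[0,T]\to\partial X$, $\gamma(0)=\gamma(T)$, $T>0$, satisfying $\dot\gamma=J\nabla g_X(\gamma)$; its action is $A(\gamma)=\frac12\int_0^T\omega(\gamma,\dot\gamma)\,dt$; and $c_{EHZ}(X)$ is the minimum of $A(\gamma)$ over all closed characteristics. For general convex bodies $c_{EHZ}$ is defined by continuous extension in the Hausdorff metric. *)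

(* Defs.v *)
From HB Require Import structures.
From mathcomp Require Import all_boot all_order all_algebra.
From mathcomp Require Import all_classical all_reals all_analysis.

Set Implicit Arguments.
Unset Strict Implicit.
Unset Printing Implicit Defensive.

Import Order.TTheory GRing.Theory Num.Theory.
Import numFieldNormedType.Exports.

Local Open Scope classical_set_scope.
Local Open Scope ring_scope.

Section Euclidean.
Context {R : realType} {m : nat}.
Implicit Types (x y : 'rV[R]_m) (X A B U : set 'rV[R]_m) (f : 'rV[R]_m -> R).

Definition dot x y : R := \sum_(i < m) x 0 i * y 0 i.

(* The library norm on row vectors is the sup norm. *)
Definition enorm x : R := Num.sqrt (dot x x).

Definition convex_body X : Prop :=
  [/\ compact X, convex_set (X : set (convex_lmodType 'rV[R]_m))
    & X° !=set0].

Definition centrally_symmetric X : Prop := [set - x | x in X] = X.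

Definition boundary X : set 'rV[R]_m := closure X `\` X°.

Definition partial (i : 'I_m) f : 'rV[R]_m -> R :=
  fun x => 'D_(delta_mx 0 i) f x.

Definition gradient f x : 'rV[R]_m := \row_(i < m) partial i f x.

Fixpoint Ck_on (k : nat) U f : Prop :=
  (forall x, U x -> {for x, continuous f}) /\
  match k with
  | 0%N => True
  | k'.+1 => forall i : 'I_m,
      (forall x, U x -> derivable f x (delta_mx 0 i)) /\
      Ck_on k' U (partial i f)
  end.

Definition smooth_on U f : Prop := forall k : nat, Ck_on k U f.

(* Near each boundary point, X is the sublevel set {rho <= 0} of a smooth
   function rho whose gradient does not vanish at that point. *)
Definition smooth_boundary X : Prop :=
  forall p, boundary X p ->
    exists (U : set 'rV[R]_m) (rho : 'rV[R]_m -> R),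
      [/\ open U, U p, smooth_on U rho, gradient rho p != 0
        & X `&` U = [set x | rho x <= 0] `&` U].

Definition gauge_fun X x : R := inf [set t : R | 0 < t /\ X (t^-1 *: x)].

(* On nonempty bounded sets the infimum is over a nonempty set. *)
Definition hausdorff_dist A B : R :=
  inf [set e : R | [/\ 0 <= e,
    (forall x, A x -> exists2 y, B y & enorm (x - y) <= e)
    & (forall y, B y -> exists2 x, A x & enorm (x - y) <= e)]].

End Euclidean.

Section Symplectic.
Context {R : realType} {n : nat}.
Implicit Types (x y : 'rV[R]_(n + n)) (X : set 'rV[R]_(n + n)).
Implicit Types (gamma : R -> 'rV[R]_(n + n)) (T a c : R).

(* A vector is written (q, p) and identified with q + sqrt(-1) p, so that
   J (q, p) = (- p, q). *)
Definition J x : 'rV[R]_(n + n) := row_mx (- rsubmx x) (lsubmx x).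

Definition omega x y : R := dot (J x) y.

Definition symplectic_polar X : set 'rV[R]_(n + n) :=
  [set y | forall x, X x -> omega x y <= 1].

(* Only the values of gamma on [0, T] matter. The equation is imposed on the
   open interval; by continuity of gamma and of the gradient of the gauge, it
   then holds at both endpoints with one-sided derivatives. *)
Definition closed_characteristic X T gamma : Prop :=
  [/\ 0 < T, gamma 0 = gamma T,
      {within `[0, T], continuous gamma},
      (forall t, t \in `[0, T] -> boundary X (gamma t))
    & (forall t, t \in `]0, T[ ->
        differentiable (gauge_fun X) (gamma t) /\
        is_derive t 1 gamma (J (gradient (gauge_fun X) (gamma t))))].

Definition action T gamma : R :=
  2^-1 * \int[@lebesgue_measure R]_(t in `[0, T]) omega (gamma t) ('D_1 gamma t).

Definition smooth_body X : Prop :=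
  [/\ convex_body X, X° 0 & smooth_boundary X].

Definition is_minimal_action X a : Prop :=
  (exists T gamma, closed_characteristic X T gamma /\ action T gamma = a) /\
  (forall T gamma, closed_characteristic X T gamma -> a <= action T gamma).

Definition smooth_approximation X
    (Y : nat -> set 'rV[R]_(n + n)) (a : nat -> R) : Prop :=
  [/\ forall k, smooth_body (Y k),
      forall k, is_minimal_action (Y k) (a k)
    & hausdorff_dist (Y k) X @[k --> \oo] --> 0].

(* c is the value at X of the continuous extension, in the Hausdorff metric, of
   the minimal action of smooth bodies. The bodies Y k have the origin in their
   interior, so a convex body X not containing the origin must be translated
   first. *)
Definition is_cEHZ X c : Prop :=
  (exists (Y : nat -> set 'rV[R]_(n + n)) (a : nat -> R),
     smooth_approximation X Y a) /\
  (forall (Y : nat -> set 'rV[R]_(n + n)) (a : nat -> R),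
     smooth_approximation X Y a -> a k @[k --> \oo] --> c).

Lemma is_cEHZ_unique X c c' : is_cEHZ X c -> is_cEHZ X c' -> c = c'.
Proof.
move=> [[Y [a Ya]] Xc] [_ Xc'].
exact: (cvg_unique _ (Xc _ _ Ya) (Xc' _ _ Ya)).
Qed.

End Symplectic.

(* Main.v *)
(* A closed characteristic of a body Y close to X has action T / 2, and its
   velocity lies in the polar of Y, hence almost in the polar C of X. As C is
   contained in X, |omega| <= 1 on C x C.  Sample the characteristic at 2M equal
   time steps: up to o(1), T is the sum of omega (w_i, w_j) over i < j, where the
   w_i are the increments. Because the curve is closed, this sum splits into the
   sums over its two halves.

   For a sequence u_1, ..., u_M of vectors of R^d (d = 2n) with pairwise
   |omega| <= 1, the sum of omega (u_i, u_j) over i < j is at most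
   d / (d + 1) * M^2 / 2 + O(M). As in the proof of Turan's theorem, this follows
   by deleting a vector of low degree: some u_k has
   sum_(i < k) omega (u_i, u_k) + sum_(j > k) omega (u_k, u_j)
   at most about d M / (d + 1). To find it, cut the sequence into d + 1 blocks of
   equal length; the block sums are linearly dependent, and the argument giving
   Schaeffer's lower bound 4 + 4 / d for the girth of a normed space shows that
   the first vector of some block will do. *)
Require Import Defs.
From mathcomp Require Import all_boot all_order all_algebra.
From mathcomp Require Import all_classical all_reals all_analysis.
From mathcomp Require Import measurable_realfun ring lra zify.

Import Order.TTheory GRing.Theory Num.Theory.
Import numFieldNormedType.Exports.

Local Open Scope classical_set_scope.
Local Open Scope ring_scope.

(** * A sign-pattern inequality for linearly dependent families *)

Lemma staircase_row_le {R : realFieldType} {d : nat} (y : 'I_d.+1 -> R)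
    (A : 'I_d.+1 -> 'I_d.+1 -> R) (L : R) :
  (exists j, y j != 0) -> (forall i, \sum_j y j * A i j = 0) ->
  (forall i j, `|A i j| <= L) ->
  exists i : 'I_d.+1,
    \sum_(j < d.+1) (if (j < i)%N then A i j else - A i j) <= d%:R * L.
Proof.
(* Otherwise every signed sum [sigma k] is smaller in modulus than the largest
   [`|y m|], although [sigma m.+1 - sigma m = 2 * y m]. *)
move=> [j0 yj0] Ay AL; apply: contrapT => /forallNP Abig.
pose s k (j : 'I_d.+1) : R := if (j < k)%N then 1 else -1.
pose sigma k := \sum_j s k j * y j.
have [m _ ymax] := @arg_maxP _ _ _ j0 xpredT (fun j => `|y j|) isT.
set Y := `|y m| in ymax.
have Ygt0 : 0 < Y by apply: lt_le_trans (ymax j0 isT); rewrite normr_gt0.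
have sy k j : `|s k j * y j| <= Y.
  by rewrite normrM /s; case: ifP => _; rewrite ?normrN normr1 mul1r; exact: ymax.
have sigma_lt_ord (i : 'I_d.+1) : L * `|sigma i| < L * Y.
  have L0 : 0 <= L by apply: le_trans (AL i i).
  rewrite -{1}(ger0_norm L0) -normrM.
  (* Signs square to 1 and row [i] of [A] annihilates [y]. The weights [L - s i j * A i j] are
     nonnegative and, by the negated conclusion, sum to less than [L]. *)
  have -> : L * sigma i = \sum_j (L - s i j * A i j) * (s i j * y j).
    transitivity (\sum_j (L * (s i j * y j) - y j * A i j)).
      by rewrite big_split /= sumrN Ay subr0 mulr_sumr.
    by apply: eq_bigr => j _; rewrite /s; case: ifP => _; ring.
  apply: le_lt_trans (ler_norm_sum _ _ _) _.
  apply: le_lt_trans (_ : (\sum_j (L - s i j * A i j)) * Y < _).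
    rewrite mulr_suml; apply: ler_sum => j _; rewrite normrM.
    have ge0 : 0 <= L - s i j * A i j.
      rewrite subr_ge0; apply: le_trans (ler_norm _) _.
      by rewrite normrM /s; case: ifP => _; rewrite ?normrN normr1 mul1r.
    by rewrite (ger0_norm ge0) ler_wpM2l.
  rewrite ltr_pM2r // big_split /= sumrN sumr_const card_ord.
  rewrite -mulr_natl -natr1 mulrDl mul1r.
  have /negP := Abig i; rewrite -ltNge.
  rewrite (eq_bigr (fun j => s i j * A i j)); last first.
    by move=> j _; rewrite /s; case: ifP => _; rewrite ?mul1r ?mulN1r.
  lra.
(* The maximal index [m] may be [d], and [d.+1] is outside the range of [sigma_lt_ord]; flipping all
   signs reduces that case to index 0. *)
have sigma_max : sigma d.+1 = - sigma 0%N.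
  rewrite /sigma -sumrN; apply: eq_bigr => j _.
  by rewrite /s ltn_ord ltn0; ring.
have sigma_lt k : (k <= d.+1)%N -> L * `|sigma k| < L * Y.
  rewrite leq_eqVlt => /orP[/eqP ->|kd]; last exact: (sigma_lt_ord (Ordinal kd)).
  by rewrite sigma_max normrN; exact: (sigma_lt_ord ord0).
have sigma_diff : sigma m.+1 - sigma m = 2 * y m.
  rewrite /sigma -sumrB (bigD1 m) //= big1 => [|j jm].
    by rewrite /s ltnSn ltnn; ring.
  by rewrite /s ltnS leq_eqVlt -[(j == m :> nat)]/(j == m) (negbTE jm) subrr.
have L0 : 0 <= L by apply: le_trans (AL m m).
have := ler_normB (sigma m.+1) (sigma m).
rewrite sigma_diff normrM ger0_norm // => /(ler_wpM2l L0).
have := sigma_lt _ (ltn_ord m); have := sigma_lt _ (ltnW (ltn_ord m)).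
rewrite -/Y; lra.
Qed.

(** * The symplectic form and its sums over ordered pairs *)

Section SymplecticForm.
Context {R : realType} {n : nat}.
Local Notation V := 'rV[R]_(n + n).
Implicit Types (x y z : V) (s : seq V).

Lemma omegaE x y : omega x y =
  \sum_(i < n) (x 0 (lshift n i) * y 0 (rshift n i)
                - x 0 (rshift n i) * y 0 (lshift n i)).
Proof.
rewrite /omega /dot big_split_ord /= -big_split; apply: eq_bigr => i _.
by rewrite /J row_mxEl row_mxEr !mxE mulNr addrC.
Qed.

Lemma omegaDl x y z : omega (x + y) z = omega x z + omega y z.
Proof. by rewrite !omegaE -big_split /=; apply: eq_bigr => i _; rewrite !mxE; ring. Qed.

Lemma omegaZl a x y : omega (a *: x) y = a * omega x y.
Proof. by rewrite !omegaE mulr_sumr; apply: eq_bigr => i _; rewrite !mxE; ring. Qed.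

Lemma omegaC x y : omega x y = - omega y x.
Proof. by rewrite !omegaE -sumrN; apply: eq_bigr => i _; ring. Qed.

Lemma omegaDr x y z : omega x (y + z) = omega x y + omega x z.
Proof. by rewrite omegaC omegaDl opprD -!omegaC. Qed.

Lemma omegaZr a x y : omega x (a *: y) = a * omega x y.
Proof. by rewrite omegaC omegaZl -mulrN -omegaC. Qed.

Lemma omega0l x : omega 0 x = 0.
Proof. by rewrite -(scale0r 0) omegaZl mul0r. Qed.

Lemma omegaNl x y : omega (- x) y = - omega x y.
Proof. by rewrite -scaleN1r omegaZl mulN1r. Qed.

Lemma omegaNr x y : omega x (- y) = - omega x y.
Proof. by rewrite -scaleN1r omegaZr mulN1r. Qed.

Lemma omegaBl x y z : omega (x - y) z = omega x z - omega y z.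
Proof. by rewrite omegaDl omegaNl. Qed.

Lemma omegaBr x y z : omega x (y - z) = omega x y - omega x z.
Proof. by rewrite omegaDr omegaNr. Qed.

Lemma omegaxx x : omega x x = 0.
Proof. by rewrite omegaE big1 // => i _; ring. Qed.

Lemma omega_suml {I : Type} (r : seq I) (F : I -> V) x :
  omega (\sum_(i <- r) F i) x = \sum_(i <- r) omega (F i) x.
Proof.
elim: r => [|i r IH]; first by rewrite !big_nil omega0l.
by rewrite !big_cons omegaDl IH.
Qed.

Definition vsum s : V := \sum_(y <- s) y.

(** This is the sum of [omega] over the pairs [i < j]: each entry is paired with the sum of the
    later ones. *)
Fixpoint ordered_omega s : R :=
  if s is x :: s' then omega x (vsum s') + ordered_omega s' else 0.

Lemma ordered_omega_cat s1 s2 : ordered_omega (s1 ++ s2) =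
  ordered_omega s1 + ordered_omega s2 + omega (vsum s1) (vsum s2).
Proof.
elim: s1 => [|x s1 IH] /=; first by rewrite /vsum big_nil omega0l; ring.
by rewrite IH /vsum big_cat /= big_cons omegaDl omegaDr; ring.
Qed.

Lemma ordered_omega_remove s1 x s2 : ordered_omega (s1 ++ x :: s2) =
  ordered_omega (s1 ++ s2) + (omega (vsum s1) x + omega x (vsum s2)).
Proof.
by rewrite !ordered_omega_cat /= {3}/vsum big_cons omegaDr -/(vsum s2); ring.
Qed.

(** The plus signs contribute [f i - f 0], the minus signs [f i - f k]. *)
Lemma staircase_telescope (f : nat -> R) i k : (i <= k)%N ->
  \sum_(j < k) (if (j < i)%N then f j.+1 - f j else - (f j.+1 - f j)) =
  2 * f i - f 0%N - f k.
Proof.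
(* The induction on [k] starts below [i], so the case [k <= i] has to be included. *)
suff H : \sum_(j < k) (if (j < i)%N then f j.+1 - f j else - (f j.+1 - f j)) =
    if (k <= i)%N then f k - f 0%N else 2 * f i - f 0%N - f k.
  move=> ik; rewrite H; case: ifP => // ki.
  have -> : i = k by apply/eqP; rewrite eqn_leq ik.
  ring.
elim: k => [|k IH]; first by rewrite big_ord0 leq0n subrr.
rewrite big_ord_recr /= IH; case: (ltngtP k i) => [ki|ki|->].
- by ring.
- by ring.
- by ring.
Qed.

Lemma linear_dependence {d : nat} (v : 'I_d.+1 -> 'rV[R]_d) :
  exists2 y : 'I_d.+1 -> R, (exists j, y j != 0) & \sum_j y j *: v j = 0.
Proof.
pose A := \matrix_(j < d.+1) v j.
have : kermx A != 0.
  rewrite kermx_eq0 /row_free; apply: contraTN isT => /eqP rA.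
  by have := rank_leq_col A; rewrite rA ltnn.
case/rowV0Pn => u /sub_kermxP uA u0; exists (u 0).
  by case/rV0Pn: u0 => j uj; exists j.
rewrite -[RHS]uA mulmx_sum_row; apply: eq_bigr => j _.
by rewrite rowK.
Qed.

(* [s] is cut into [2n + 1] nearly equal blocks; their sums are linearly
   dependent, and [x] is the first vector of one of the blocks. *)
Lemma low_degree_vector s (k : R) : s != [::] ->
  {in s &, forall x y, `|omega x y| <= k} ->
  exists s1 x s2, s = s1 ++ x :: s2 /\
    omega (vsum s1) x + omega x (vsum s2)
      <= (n + n)%:R * (k * (size s %/ (n + n).+1).+1%:R).
Proof.
move=> s0 sk; set m := size s; set d := (n + n)%N.
have m0 : (0 < m)%N by rewrite lt0n size_eq0.
pose b i := (i * m %/ d.+1)%N.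
have b0 : b 0%N = 0%N by rewrite /b mul0n div0n.
have bd : b d.+1 = m by rewrite /b mulKn.
have bm i : (i < d.+1)%N -> (b i < m)%N.
  by move=> id; rewrite /b ltn_divLR // mulnC ltn_pmul2l.
(* The carry in [divnD] is at most 1, so a block has at most [m %/ d.+1 + 1] entries. *)
have bS i : (b i <= b i.+1 <= b i + (m %/ d.+1).+1)%N.
  rewrite /b mulSn addnC divnD // -addnA leq_addr leq_add2l /=.
  by rewrite -[leqRHS]addn1 leq_add2l leq_b1.
pose P i := vsum (take (b i) s).
(* By [bm] the default [0] is never read for [i <= d]. Blocks may be empty when [m <= d], and [x i]
   is still an entry of [s]. *)
pose x i := nth 0 s (b i).
pose D i := P i.+1 - P i.
have k0 : 0 <= k.
  by have xs := mem_nth 0 m0; apply: le_trans (sk _ _ xs xs).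
have xs i : (i < d.+1)%N -> x i \in s by move=> /bm; exact: mem_nth.
have DE i : D i = vsum (take (b i.+1 - b i) (drop (b i) s)).
  have bi : (b i <= b i.+1)%N by case/andP: (bS i).
  rewrite /D; have -> : P i.+1 = P i + vsum (take (b i.+1 - b i) (drop (b i) s)).
    by rewrite /P /vsum -big_cat -takeD subnKC.
  by rewrite addrC addKr.
have Dx (i j : 'I_d.+1) : `|omega (D j) (x i)| <= k * (m %/ d.+1).+1%:R.
  rewrite DE /vsum omega_suml; apply: le_trans (ler_norm_sum _ _ _) _.
  set t := take _ _.
  have ts y : y \in t -> y \in s by move=> /mem_take /mem_drop.
  apply: le_trans (_ : k * (size t)%:R <= _).
    rewrite mulr_natr -(count_predT t) -iter_addr_0 -big_const_seq.
    by rewrite big_seq [leRHS]big_seq; apply: ler_sum => y /ts yt; apply: sk => //; exact: xs.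
  rewrite ler_wpM2l // ler_nat /t size_take_min.
  apply: leq_trans (geq_minl _ _) _.
  by rewrite leq_subLR; case/andP: (bS j).
have [y yn0 yD] := linear_dependence D.
have [|i] := staircase_row_le y (fun i j => omega (D j) (x i)) _ yn0 _ Dx.
  move=> i; rewrite -[RHS](omega0l (x i)) -yD omega_suml.
  by apply: eq_bigr => j _; rewrite omegaZl.
set g := \sum_(j < _) _ => gle.
exists (take (b i) s), (x i), (drop (b i).+1 s).
have bi := bm _ (ltn_ord i).
split; first by rewrite -drop_nth // cat_take_drop.
suff <- : g = omega (vsum (take (b i) s)) (x i) + omega (x i) (vsum (drop (b i).+1 s)) by [].
rewrite /g (eq_bigr (fun j : 'I_d.+1 => if (j < i)%N
  then omega (P j.+1) (x i) - omega (P j) (x i)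
  else - (omega (P j.+1) (x i) - omega (P j) (x i)))); last first.
  by move=> j _; rewrite /D omegaBl.
(* With [P 0 = 0], what remains is [2 * omega (P i) (x i) - omega (P d.+1) (x i)]. The vector [x i]
   itself occurs in [P d.+1], but pairs to 0 with itself. *)
rewrite (staircase_telescope (fun j => omega (P j) (x i))) ?(ltnW (ltn_ord i)) //.
have -> : P 0%N = 0 by rewrite /P b0 take0 /vsum big_nil.
have -> : P d.+1 = P i + (x i + vsum (drop (b i).+1 s)).
  by rewrite /P bd take_size -[LHS]/(vsum s) -{1}(cat_take_drop (b i) s)
    (drop_nth 0 bi) /vsum big_cat big_cons.
rewrite !omegaDl omega0l omegaxx [omega (x i) _]omegaC /P; ring.
Qed.

(** Deleting a low-degree vector from a sequence of length [m] costs at most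
    [d * k * (m / d.+1 + 1)], where [d = n + n]. Summing these costs over all lengths up to [size s]
    gives the two terms of the bound. *)
Lemma ordered_omega_le s (k : R) :
  {in s &, forall x y, `|omega x y| <= k} ->
  ordered_omega s <= k * ((n + n)%:R / (n + n).+1%:R
    * ((size s)%:R * (size s).+1%:R / 2) + (n + n)%:R * (size s)%:R).
Proof.
move: {2}(size s) (erefl (size s)) => m; elim: m s => [|m IH] s.
  by move=> /size0nil -> _ /=; rewrite mul0r !mulr0 mul0r mulr0 addr0 mulr0.
move=> sm sk.
have s0 : s != [::] by rewrite -size_eq0 sm.
have [s1 [x [s2 [sE]]]] := low_degree_vector s k s0 sk.
have s12 : size (s1 ++ s2) = m.
  by apply/succn_inj; rewrite -sm sE !size_cat /= addnS.
rewrite sm => gx; rewrite [in ordered_omega s]sE ordered_omega_remove.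
have k0 : 0 <= k.
  by apply: le_trans (sk x x _ _); rewrite // sE mem_cat inE eqxx orbT.
have s12s : {subset s1 ++ s2 <= s}.
  by move=> u; rewrite sE !mem_cat inE => /orP[] ->; rewrite ?orbT.
have := IH _ s12 (sub_in2 s12s sk).
rewrite s12; move: gx; set d := (n + n)%N; set F := ordered_omega _; set g := _ + _.
have quot_le : (m.+1 %/ d.+1)%:R <= (m.+1%:R / d.+1%:R : R).
  by rewrite ler_pdivlMr ?ltr0n // -natrM ler_nat leq_trunc_div.
have dk : 0 <= d%:R * k by rewrite mulr_ge0.
move: (ler_wpM2l dk quot_le).
have natS j : j.+1%:R = j%:R + 1 :> R by rewrite natr1.
rewrite !(natS m.+1) !(natS m) (natS (_ %/ _)%N).
set Q := (_ %/ _)%:R; set e := (d.+1%:R)^-1 => q' gle Fle.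
nra.
Qed.

End SymplecticForm.

(** * A mean value theorem for curves paired with a fixed vector *)

Section Calculus.
Context {R : realType} {n : nat}.
Local Notation V := 'rV[R]_(n + n).
Implicit Types x : V.

Lemma continuous_bigsum {W : topologicalType} {I : Type} (r : seq I)
    (f : I -> W -> R) :
  (forall i, continuous (f i)) -> continuous (fun w => \sum_(i <- r) f i w).
Proof.
move=> cf; elim: r => [|i r IH] w.
  by under eq_fun do rewrite big_nil; exact: cst_continuous.
by under eq_fun do rewrite big_cons; exact: cvgD (cf i w) (IH w).
Qed.

Lemma omega_continuous x : continuous (omega x).
Proof.
apply: continuous_bigsum => i y.
by apply: continuousM; [exact: cst_continuous | exact: coord_continuous].
Qed.

Lemma is_derive_omega x (gamma : R -> V) (t : R) v :
  is_derive t 1 gamma v ->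
  is_derive t 1 (fun u => omega x (gamma u)) (omega x v).
Proof.
move=> [dg gE].
have gi i : is_derive t 1 (fun u => gamma u 0 i) (v 0 i).
  apply: DeriveDef; first by move/derivable_mxP : dg; apply.
  by rewrite -gE derive_mx // mxE.
pose h i : R -> R := J x 0 i \*: (fun u => gamma u 0 i).
have -> : (fun u => omega x (gamma u)) = \sum_(i < n + n) h i.
  by apply/funext => u; rewrite fct_sumE.
apply: (@is_derive_sum _ _ _ _ h t 1 (fun i => J x 0 i *: v 0 i)).
Qed.

(** Pairing with a fixed [x] makes the curve scalar, so the mean value theorem applies; the
    intermediate time depends on [x]. *)
Lemma omega_MVT x (gamma v : R -> V) (T s t : R) :
  {within `[0, T], continuous gamma} ->
  (forall u, u \in `]0, T[ -> is_derive u 1 gamma (v u)) ->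
  0 <= s -> s < t -> t <= T ->
  exists2 u, s < u < t & omega x (gamma t - gamma s) = omega x (v u) * (t - s).
Proof.
move=> gcont gder s0 st tT.
have dw u : u \in `]s, t[ ->
    is_derive u 1 (fun u => omega x (gamma u)) (omega x (v u)).
  rewrite in_itv /= => /andP[su ut]; apply/is_derive_omega/gder.
  by rewrite in_itv /= (le_lt_trans s0 su) (lt_le_trans ut tT).
have gst : {within `[s, t], continuous gamma}.
  apply: continuous_subspaceW gcont => u /=; rewrite !in_itv /= => /andP[su ut].
  by rewrite (le_trans s0 su) (le_trans ut tT).
have wst : {within `[s, t], continuous (fun u => omega x (gamma u))}.
  apply: (@within_continuous_comp _ _ _ `[s, t] gamma (omega x)) gst.
  by move=> y _; exact: omega_continuous.
have [u + E] := MVT st dw wst.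
by rewrite in_itv /= => ust; exists u => //; rewrite omegaBr.
Qed.

End Calculus.

(** * Lower bound for the period of a closed curve *)

Section ClosedCurves.
Context {R : realType} {n : nat}.
Local Notation V := 'rV[R]_(n + n).
Implicit Types (x y z : V) (X : set V) (p : nat -> V).

(** The vector [a^-1 *: y] lies in the symplectic polar, hence in [X], where the bound on [z]
    applies. *)
Lemma symplectic_polar_omega_le X y z (a b : R) :
  symplectic_polar X `<=` X -> 0 < a ->
  (forall x, X x -> omega x y <= a) -> (forall x, X x -> omega x z <= b) ->
  omega y z <= a * b.
Proof.
move=> polX a0 ya zb.
have /polX/zb : symplectic_polar X (a^-1 *: y).
  by move=> x Xx; rewrite omegaZr mulrC ler_pdivrMr ?mul1r ?ya.
by rewrite omegaZl mulrC ler_pdivrMr // mulrC.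
Qed.

Lemma vsum_increments p i k :
  vsum [seq p j.+1 - p j | j <- iota i k] = p (i + k)%N - p i.
Proof.
rewrite /vsum big_map -[iota i k]/(iota i k) -{1}(addKn i k) -/(index_iota i (i + k)).
by rewrite telescope_sumr ?leq_addr.
Qed.

(** The increments before the [j]-th sum to [p j - p 0]. Pairing with [p j] gives
    [omega (p j) (p j.+1)]; pairing with [p 0] telescopes. *)
Lemma ordered_omega_increments p k :
  ordered_omega [seq p j.+1 - p j | j <- iota 0 k] =
  \sum_(j < k) omega (p j) (p j.+1) - omega (p 0%N) (p k).
Proof.
elim: k => [|k IH]; first by rewrite big_ord0 omegaxx subrr.
have -> : iota 0 k.+1 = iota 0 k ++ [:: k] by rewrite -addn1 iotaD.
rewrite map_cat ordered_omega_cat IH vsum_increments /= add0n.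
rewrite /vsum big_nil big_seq1 big_ord_recr /= [omega _ 0]omegaC omega0l.
rewrite !(omegaBl, omegaBr) omegaxx; ring.
Qed.

(** The two halves have opposite total increments, so their cross term vanishes. This pays off
    because [ordered_omega_le] is quadratic in the length: two halves cost about half as much as the
    whole. *)
Lemma ordered_omega_closed_increments p k :
  p (k + k)%N = p 0%N ->
  \sum_(j < k + k) omega (p j) (p j.+1) =
  ordered_omega [seq p j.+1 - p j | j <- iota 0 k] +
  ordered_omega [seq p j.+1 - p j | j <- iota k k].
Proof.
move=> pk; have := ordered_omega_increments p (k + k).
rewrite pk omegaxx subr0 => <-.
rewrite iotaD map_cat ordered_omega_cat !vsum_increments !add0n pk.
by rewrite -opprB omegaNl omegaxx oppr0 addr0.
Qed.

Lemma closed_curve_length_ge X (gamma v : R -> V) (T r : R) :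
  symplectic_polar X `<=` X -> 0 < T -> 0 < r ->
  gamma 0 = gamma T -> {within `[0, T], continuous gamma} ->
  (forall t, t \in `]0, T[ -> is_derive t 1 gamma (v t)) ->
  (forall t, t \in `]0, T[ -> forall x, X x -> omega x (v t) <= r) ->
  (forall t, t \in `]0, T[ -> omega (gamma t) (v t) = 1) ->
  4 <= r ^+ 2 * T * ((n + n)%:R / (n + n).+1%:R).
Proof.
move=> polX T0 r0 gclosed gcont gder vr gv.
have incr s t : 0 <= s -> s < t -> t <= T ->
    forall x, X x -> omega x (gamma t - gamma s) <= r * (t - s).
  move=> s0 st tT x Xx.
  have [u /andP[su ut] ->] := omega_MVT x gamma v T s t gcont gder s0 st tT.
  rewrite ler_wpM2r ?subr_ge0 ?(ltW st) // vr // in_itv /=.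
  by rewrite (le_lt_trans s0 su) (lt_le_trans ut tT).
(* The mean value theorem produces [omega (gamma s) (v u)]. Replacing [gamma s] by [gamma u], where
   the value is 1, costs at most [r ^+ 2 * (u - s)]. *)
have step s t : 0 <= s -> s < t -> t <= T ->
    (t - s) * (1 - r ^+ 2 * (t - s)) <= omega (gamma s) (gamma t).
  move=> s0 st tT.
  have [u /andP[su ut]] := omega_MVT (gamma s) gamma v T s t gcont gder s0 st tT.
  rewrite omegaBr omegaxx subr0 => ->.
  have uT : u \in `]0, T[.
    by rewrite in_itv /= (le_lt_trans s0 su) (lt_le_trans ut tT).
  have := gv u uT.
  have : omega (gamma u - gamma s) (v u) <= r * (u - s) * r.
    apply: symplectic_polar_omega_le _ _ _ _ _ polX _ _ (vr u uT).
      by rewrite mulr_gt0 // subr_gt0.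
    by apply: incr => //; exact: le_trans (ltW ut) tT.
  rewrite omegaBl => h1 h2; rewrite mulrC ler_wpM2r ?subr_ge0 ?(ltW st) //.
  have : r ^+ 2 * (u - s) <= r ^+ 2 * (t - s).
    by rewrite ler_wpM2l ?sqr_ge0 // lerB // ltW.
  by rewrite expr2; lra.
set d := (n + n)%N; set e : R := d%:R / d.+1%:R.
have e0 : 0 <= e by rewrite divr_ge0.
(* The [2 * M] steps of length [h] contribute at least [h * (1 - r ^+ 2 * h)] each; the two halves
   are bounded above by [ordered_omega_le]. Substituting [2 * M * h = T] leaves an inequality whose
   terms linear in [M] give the claim. *)
have sampled M : (0 < M)%N ->
    2 * M%:R <= M%:R * (r ^+ 2 * T * e / 2) + r ^+ 2 * T * (e / 2 + d%:R + 1).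
  move=> M0; have MR : 0 < M%:R :> R by rewrite ltr0n.
  pose h := T / (M + M)%:R.
  have h0 : 0 < h by rewrite divr_gt0 // ltr0n addn_gt0 M0.
  have hM : (M + M)%:R * h = T by rewrite mulrC divfK // pnatr_eq0 addn_eq0; lia.
  pose p j := gamma (j%:R * h).
  have pstep j : (j < M + M)%N ->
      [/\ 0 <= j%:R * h, j%:R * h < j.+1%:R * h, j.+1%:R * h <= T
        & j.+1%:R * h - j%:R * h = h].
    move=> jM; split; first by rewrite mulr_ge0 // ltW.
    - by rewrite ltr_pM2r // ltr_nat.
    - by rewrite -hM ler_pM2r // ler_nat.
    - by rewrite -natr1; ring.
  have pclosed : p (M + M)%N = p 0%N by rewrite /p mul0r hM gclosed.
  have wle i j : (i < M + M)%N -> (j < M + M)%N ->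
      omega (p i.+1 - p i) (p j.+1 - p j) <= (r * h) ^+ 2.
    move=> /pstep[i0 i1 i2 i3] /pstep[j0 j1 j2 j3]; rewrite expr2.
    apply: symplectic_polar_omega_le _ _ _ _ _ polX _ _ _; first by rewrite mulr_gt0.
      by rewrite -i3; exact: incr.
    by rewrite -j3; exact: incr.
  have half a : (a + M <= M + M)%N ->
      ordered_omega [seq p j.+1 - p j | j <- iota a M] <=
      (r * h) ^+ 2 * (e * (M%:R * M.+1%:R / 2) + d%:R * M%:R).
    move=> aM; set s := map _ _.
    have sM : size s = M by rewrite size_map size_iota.
    have := @ordered_omega_le _ _ s ((r * h) ^+ 2); rewrite sM; apply.
    move=> _ _ /mapP[i + ->] /mapP[j + ->]; rewrite !mem_iota => iM jM.
    rewrite ler_norml -lerNl -omegaC !wle //; lia.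
  have : \sum_(j < M + M) (h * (1 - r ^+ 2 * h)) <=
         \sum_(j < M + M) omega (p j) (p j.+1).
    apply: ler_sum => j _; have [j0 j1 j2 j3] := pstep j (ltn_ord j).
    by rewrite -{1 2}j3; exact: step.
  rewrite (ordered_omega_closed_increments p M pclosed) sumr_const card_ord.
  rewrite -[X in X <= _]mulr_natl.
  have := half M (leqnn _); have := half 0%N (leq_addr _ _).
  set F0 := ordered_omega _; set F1 := ordered_omega _.
  have -> : M.+1%:R = M%:R + 1 :> R by rewrite natr1.
  have MM : (M + M)%:R = 2 * M%:R :> R by rewrite natrD; ring.
  rewrite MM -hM MM => F0le F1le sumle.
  have {F0le F1le sumle} : M%:R * (h * (1 - r ^+ 2 * h)) <=
     (r * h) ^+ 2 * (e * (M%:R * (M%:R + 1) / 2) + d%:R * M%:R) by lra.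
  have -> : (r * h) ^+ 2 * (e * (M%:R * (M%:R + 1) / 2) + d%:R * M%:R) =
    M%:R * (h * (r ^+ 2 * h * (e * (M%:R + 1) / 2 + d%:R))) by field.
  rewrite !ler_pM2l // => /(ler_wpM2l (ltW MR)).
  lra.
rewrite leNgt; apply/negP => small.
(* Twice [sampled] reads [M * g <= B], which fails once [M] exceeds [B / g]. *)
set g := 4 - r ^+ 2 * T * e; set B := r ^+ 2 * T * (e + 2 * d%:R + 2).
have g0 : 0 < g by rewrite subr_gt0.
have B0 : 0 <= B.
  apply: mulr_ge0; first by rewrite mulr_ge0 ?sqr_ge0 // ltW.
  have := ler0n R d; lra.
have := archi_boundP (divr_ge0 B0 (ltW g0)).
set M := Num.bound _ => BM.
have M0 : (0 < M)%N.
  by rewrite -(ltr0n R); apply: le_lt_trans BM; rewrite divr_ge0 // ltW.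
have := sampled M M0; move: BM; rewrite ltr_pdivrMr // /B /g; lra.
Qed.

End ClosedCurves.

(** * The gauge of a convex neighbourhood of the origin and its gradient *)

Section Gauge.
Context {R : realType} {m : nat}.
Local Notation V := 'rV[R]_m.
Implicit Types (x y p : V) (Y : set V) (t : R).

Lemma convex_setE Y x y t :
  convex_set (Y : set (convex_lmodType V)) -> Y x -> Y y ->
  0 <= t <= 1 -> Y (t *: x + (1 - t) *: y).
Proof.
move=> cY Yx Yy t01.
have t01' : Itv.spec (@Itv.num_sem _) (Itv.Real `[Posz 0, Posz 1]) t.
  by rewrite /= /Itv.num_sem /= in_itv /= ger0_real //; case/andP: t01.
by have /set_mem := cY x y (Itv.mk t01') (mem_set Yx) (mem_set Yy).
Qed.

Lemma interior_ball Y x : Y° x ->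
  exists2 e, 0 < e & forall y, `|y - x| < e -> Y y.
Proof.
move=> /nbhs_ballP[e /= e0 He]; exists e => // y yx; apply: He.
by rewrite -ball_normE /= distrC.
Qed.

(** Since the derivative exists, small positive [h] determine it. The restriction [h < 1] keeps
    [1 - h] positive when moving from a point towards the origin. *)
Lemma derive_le (f : V -> R) x v c : derivable f x v ->
  (forall h, 0 < h -> h < 1 -> f (h *: v + x) <= f x + h * c) ->
  'D_v f x <= c.
Proof.
move=> df fc; rewrite leNgt; apply/negP => cD.
have : \forall h \near 0^', c < h^-1 *: (f (h *: v + x) - f x).
  exact: (cvgr_gt _ df).
move=> /nbhs_ballP[e /= e0 He].
pose h := Num.min (e / 2) (1 / 2).
have h0 : 0 < h by rewrite lt_min !divr_gt0.
have he : h < e by rewrite gt_min; apply/orP; left; lra.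
have h1 : h < 1 by rewrite gt_min; apply/orP; right; lra.
have : c < h^-1 *: (f (h *: v + x) - f x).
  apply: He; last by rewrite gt_eqF.
  by rewrite -ball_normE /= sub0r normrN gtr0_norm.
rewrite -[_ *: _]/(_ * _) mulrC ltr_pdivlMr // ltrBrDl mulrC => lt1.
by have := fc h h0 h1; rewrite leNgt lt1.
Qed.

Lemma dot_gradient (f : V -> R) x y :
  differentiable f x -> dot y (gradient f x) = 'D_y f x.
Proof.
move=> df; rewrite deriveE // {2}(row_sum_delta y) linear_sum.
by apply: eq_bigr => i _; rewrite linearZ /= mxE /partial deriveE.
Qed.

Section ConvexNeighbourhood.
Context (Y : set V).
Hypotheses (cY : convex_set (Y : set (convex_lmodType V))) (Y0 : Y° 0).

Let Yzero : Y 0. Proof. exact: interior_subset. Qed.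

Lemma gauge_set_nonempty x : [set t | 0 < t /\ Y (t^-1 *: x)] !=set0.
Proof.
have [e e0 Ye] := interior_ball _ _ Y0.
exists ((`|x| + 1) / e); split; first by rewrite divr_gt0 // ltr_wpDl.
apply: Ye; rewrite subr0 normrZ ger0_norm; last first.
  by rewrite invr_ge0 divr_ge0 ?addr_ge0 // ltW.
rewrite invf_div mulrAC ltr_pdivrMr ?ltr_wpDl //.
by rewrite ltr_pM2l // ltrDl.
Qed.

Lemma gauge_set_lbound x : has_lbound [set t | 0 < t /\ Y (t^-1 *: x)].
Proof. by exists 0 => t [/ltW]. Qed.

Lemma gauge_le x t : 0 < t -> Y (t^-1 *: x) -> gauge_fun Y x <= t.
Proof. by move=> t0 Yx; apply: (ge_inf (gauge_set_lbound x)). Qed.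

Lemma gauge_ge0 x : 0 <= gauge_fun Y x.
Proof. by apply: lb_le_inf (gauge_set_nonempty x) _ => t [/ltW]. Qed.

Lemma gauge_lt x t : gauge_fun Y x < t -> Y (t^-1 *: x).
Proof.
move=> /(inf_lt (gauge_set_nonempty x))[s [s0 Ys] st].
have t0 : 0 < t by exact: lt_trans st.
have -> : t^-1 *: x = (s / t) *: (s^-1 *: x) + (1 - s / t) *: 0.
  by rewrite scaler0 addr0 scalerA mulrAC divff ?mul1r // gt_eqF.
apply: convex_setE => //.
by rewrite divr_ge0 ?(ltW s0) ?(ltW t0) //= ler_pdivrMr // mul1r ltW.
Qed.

Lemma gauge_subadditive x y :
  gauge_fun Y (x + y) <= gauge_fun Y x + gauge_fun Y y.
Proof.
apply/ler_addgt0Pr => e e0; set a := gauge_fun Y x; set b := gauge_fun Y y.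
have a0 : 0 < a + e / 2 by rewrite ltr_wpDl ?gauge_ge0 // divr_gt0.
have b0 : 0 < b + e / 2 by rewrite ltr_wpDl ?gauge_ge0 // divr_gt0.
have Ya : Y ((a + e / 2)^-1 *: x) by apply: gauge_lt; rewrite ltrDl divr_gt0.
have Yb : Y ((b + e / 2)^-1 *: y) by apply: gauge_lt; rewrite ltrDl divr_gt0.
have -> : a + b + e = (a + e / 2) + (b + e / 2) by lra.
move: a0 b0 Ya Yb; move: (a + _) (b + _) => s t s0 t0 Ys Yt.
have st0 : 0 < s + t by rewrite addr_gt0.
apply: gauge_le => //.
have -> : (s + t)^-1 *: (x + y) =
    (s / (s + t)) *: (s^-1 *: x) + (1 - s / (s + t)) *: (t^-1 *: y).
  rewrite !scalerA scalerDr; congr (_ *: _ + _ *: _); field;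
  by rewrite ?(gt_eqF s0) ?(gt_eqF t0) ?(gt_eqF st0).
apply: convex_setE => //.
by rewrite divr_ge0 ?(ltW s0) ?(ltW st0) //= ler_pdivrMr // mul1r lerDl ltW.
Qed.

Lemma gauge_scale_le a x : 0 < a -> gauge_fun Y (a *: x) <= a * gauge_fun Y x.
Proof.
move=> a0; rewrite mulrC -ler_pdivrMr //.
apply: lb_le_inf (gauge_set_nonempty x) _ => t [t0 Yt].
rewrite ler_pdivrMr //; apply: gauge_le; first by rewrite mulr_gt0.
by rewrite scalerA invfM mulfVK // gt_eqF.
Qed.

(** If the gauge were below some [t < 1], then [p] would be [t] times a point of [Y]. Adding [1 - t]
    times a ball around 0 would give a ball around [p] inside [Y]. *)
Lemma gauge_boundary p : closed Y -> boundary Y p -> gauge_fun Y p = 1.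
Proof.
move=> clY [/clY Yp npint]; apply/eqP; rewrite eq_le.
rewrite gauge_le ?invr1 ?scale1r //= leNgt; apply/negP => g1; apply: npint.
pose t := (gauge_fun Y p + 1) / 2.
have gt : gauge_fun Y p < t by rewrite /t; lra.
have t1 : t < 1 by rewrite /t; lra.
have t0 : 0 < t by have := gauge_ge0 p; rewrite /t; lra.
have [e e0 Ye] := interior_ball _ _ Y0.
apply/nbhs_ballP; exists ((1 - t) * e) => /=; first by rewrite mulr_gt0 ?subr_gt0.
move=> y; rewrite -ball_normE /= distrC => py.
have -> : y = t *: (t^-1 *: p) + (1 - t) *: ((1 - t)^-1 *: (y - p)).
  rewrite !scalerA !divff ?scale1r ?(gt_eqF t0) ?gt_eqF ?subr_gt0 //.
  by rewrite addrC subrK.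
apply: convex_setE (gauge_lt _ _ gt) _ _ => //; last by rewrite !ltW.
apply: Ye; rewrite subr0 normrZ ger0_norm ?invr_ge0 ?subr_ge0 ?(ltW t1) //.
by rewrite mulrC ltr_pdivrMr ?subr_gt0 // mulrC.
Qed.

(** Subadditivity bounds the gauge at [p + h *: y] by [1 + h]. Thus the gradient lies in the
    ordinary polar of [Y]. *)
Lemma dot_gradient_gauge_le1 p y :
  gauge_fun Y p = 1 -> differentiable (gauge_fun Y) p -> Y y ->
  dot y (gradient (gauge_fun Y) p) <= 1.
Proof.
move=> gp dg Yy; rewrite dot_gradient //; apply: derive_le => [|h h0 _].
  exact: diff_derivable.
rewrite addrC; apply: le_trans (gauge_subadditive _ _) _.
rewrite lerD2l; apply: le_trans (gauge_scale_le _ _ h0) _.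
by rewrite ler_wpM2l ?(ltW h0) // gauge_le // invr1 scale1r.
Qed.

(* The difference quotient in the direction [- p] is constant. *)
Lemma dot_gradient_gauge_self p :
  closed Y -> boundary Y p -> differentiable (gauge_fun Y) p ->
  dot p (gradient (gauge_fun Y) p) = 1.
Proof.
move=> clY bp dg; have gp := gauge_boundary _ clY bp.
apply/eqP; rewrite eq_le dot_gradient_gauge_le1 //=; last exact: clY bp.1.
rewrite dot_gradient // -lerN2 -[X in X <= _]opprK opprK.
have -> : - 'D_p (gauge_fun Y) p = 'D_(- p) (gauge_fun Y) p.
  by rewrite !deriveE // linearN.
apply: derive_le => [|h h0 h1]; first exact: diff_derivable.
have -> : h *: (- p) + p = (1 - h) *: p by rewrite scalerBl scale1r scalerN addrC.
apply: le_trans (gauge_scale_le _ _ _) _; first by rewrite subr_gt0.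
by rewrite gp; lra.
Qed.

End ConvexNeighbourhood.
End Gauge.

(** * Comparison of norms, and Hausdorff approximation *)

Section Norms.
Context {R : realType} {m : nat}.
Implicit Types (x y : 'rV[R]_m) (X Y : set 'rV[R]_m).

Lemma coord_le_norm x i : `|x 0 i| <= `|x|.
Proof. by rewrite [leRHS]/Num.norm /= mx_normrE; exact: (le_bigmax _ _ (0, i)). Qed.

Lemma norm_le_coord x a : 0 <= a -> (forall i, `|x 0 i| <= a) -> `|x| <= a.
Proof.
move=> a0 xa; rewrite [leLHS]/Num.norm /= mx_normrE.
by apply: bigmax_le => //= -[i j] _; rewrite ord1.
Qed.

Lemma coord_le_enorm x i : `|x 0 i| <= enorm x.
Proof.
rewrite -sqrtr_sqr ler_wsqrtr // /dot (bigD1 i) //= -expr2 lerDl.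
by apply: sumr_ge0 => j _; rewrite -expr2 sqr_ge0.
Qed.

Lemma enorm_le x a : `|x| <= a -> enorm x <= Num.sqrt (m%:R * a ^+ 2).
Proof.
move=> xa; rewrite ler_wsqrtr // /dot.
have -> : m%:R * a ^+ 2 = \sum_(i < m) a ^+ 2.
  by rewrite sumr_const card_ord mulr_natl.
apply: ler_sum => i _; have xia := le_trans (coord_le_norm x i) xa.
by rewrite -expr2 -real_normK ?num_real // lerXn2r ?nnegrE // (le_trans _ xia).
Qed.

(** Averaging a ball around an interior point [x0] with the point [- x0] gives a ball around the
    origin. *)
Lemma symmetric_body_ball X : convex_body X -> centrally_symmetric X ->
  exists2 rho, 0 < rho & forall x, `|x| <= rho -> X x.
Proof.
move=> [_ cX [x0 intx0]] symX.
have [e e0 Xe] := interior_ball _ _ intx0.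
exists (e / 4) => [|x xe]; first by rewrite divr_gt0.
have X0 : X x0 by exact: interior_subset.
have XN0 : X (- x0) by rewrite -symX; exists x0.
have -> : x = 2^-1 *: (x0 + 2 *: x) + (1 - 2^-1) *: (- x0).
  by apply/rowP => i; rewrite !mxE; field.
apply: (convex_setE X _ _ _ cX _ XN0); last by rewrite invr_ge0 ler0n invf_le1 ?ler1n.
by apply: Xe; rewrite addrC addKr normrZ ger0_norm //; lra.
Qed.

(** An infimum is approached by members only if its set is nonempty; boundedness of both bodies
    supplies a member. *)
Lemma hausdorff_dist_lt X Y e : convex_body X -> convex_body Y ->
  hausdorff_dist Y X < e ->
  exists2 e', e' < e & forall x, X x -> exists2 y, Y y & enorm (x - y) <= e'.
Proof.
move=> [/compact_bounded bX _ [x0 /interior_subset Xx0]].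
move=> [/compact_bounded bY _ [y0 /interior_subset Yy0]].
have [M XM] : exists M, forall x, X x -> `|x| <= M.
  by case: bX => N [_ XN]; exists (N + 1) => x Xx; apply: (XN (N + 1)) => //; rewrite ltrDl.
have [N YN] : exists N, forall y, Y y -> `|y| <= N.
  by case: bY => K [_ YK]; exists (K + 1) => y Yy; apply: (YK (K + 1)) => //; rewrite ltrDl.
have distXY x y : X x -> Y y -> enorm (y - x) <= Num.sqrt (m%:R * (N + M) ^+ 2).
  move=> /XM xM /YN yN; apply: enorm_le.
  by apply: le_trans (ler_normB _ _) _; exact: lerD.
have enormB x y : enorm (x - y) = enorm (y - x).
  by rewrite /enorm /dot; congr Num.sqrt; apply: eq_bigr => i _; rewrite !mxE; ring.
move=> /inf_lt[].
  exists (Num.sqrt (m%:R * (N + M) ^+ 2)); split; first exact: sqrtr_ge0.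
    by move=> y Yy; exists x0 => //; exact: distXY.
  by move=> x Xx; exists y0 => //; exact: distXY.
move=> e' [_ _ XY] e'e; exists e' => // x /XY[y Yy yx].
by exists y => //; rewrite enormB.
Qed.

End Norms.

(** * Closed characteristics of bodies close to [X] *)

Section Characteristics.
Context {R : realType} {n : nat}.
Local Notation V := 'rV[R]_(n + n).
Implicit Types (x y v : V) (X Y : set V).

Lemma omega_J x y : omega x (J y) = dot x y.
Proof.
rewrite omegaE /dot big_split_ord /= -big_split; apply: eq_bigr => i _ /=.
by rewrite /J row_mxEl row_mxEr !mxE; ring.
Qed.

(** Euler's identity for the gauge makes the integrand equal to 1. *)
Lemma closed_characteristic_action Y T gamma :
  convex_set (Y : set (convex_lmodType V)) -> closed Y -> Y° 0 ->
  closed_characteristic Y T gamma -> action T gamma = T / 2.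
Proof.
move=> cY clY Y0 [T0 _ _ bg gder].
have omega1 t : t \in `]0, T[ -> omega (gamma t) ('D_1 gamma t) = 1.
  move=> tT; have [dg gt] := gder t tT.
  rewrite derive_val omega_J dot_gradient_gauge_self //; apply: bg.
  exact: subset_itv_oo_cc tT.
(* The derivative of [gamma] is not controlled at the endpoints, which form a null set. *)
rewrite /action /Rintegral integral_itv_bndoo; last first.
  apply/measurable_EFinP.
  have mcst : measurable_fun `]0, T[ (cst 1 : R -> R) by exact: measurable_cst.
  by apply: eq_measurable_fun mcst => t /set_mem /omega1 ->.
rewrite (eq_integral (cst 1%:E)); last by move=> t /set_mem /omega1 ->.
rewrite integral_cst //= lebesgue_measure_itv /= lte_fin T0 mul1e -EFinB subr0 /=.
by rewrite mulrC.
Qed.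

Lemma omega_le_enorm x v :
  omega x v <= enorm x * \sum_(i < n + n) `|v 0 i|.
Proof.
rewrite omegaE big_split_ord /= -big_split mulr_sumr; apply: ler_sum => i _ /=.
rewrite mulrDr addrC -mulNr; apply: lerD;
  by apply: le_trans (ler_norm _) _; rewrite normrM ?normrN ler_wpM2r ?coord_le_enorm.
Qed.

(** Duality of the sup and l^1 norms: the witness is built from the signs of the coordinates of [v],
    with the two halves exchanged by [omega]. *)
Lemma omega_sup_ball (a : R) v : 0 <= a ->
  exists2 x : V, `|x| <= a & omega x v = a * \sum_(i < n + n) `|v 0 i|.
Proof.
move=> a0; exists (row_mx (\row_i (a * Num.sg (v 0 (rshift n i))))
                          (\row_i (- (a * Num.sg (v 0 (lshift n i)))))).
  apply: norm_le_coord => // i; case: (split_ordP i) => j ->;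
  rewrite ?row_mxEl ?row_mxEr mxE ?normrN normrM (ger0_norm a0) ler_piMr //;
  by rewrite normr_sg lern1 leq_b1.
rewrite omegaE big_split_ord /= -big_split mulr_sumr; apply: eq_bigr => i _ /=.
rewrite row_mxEl row_mxEr !mxE !(mulNr, opprK) -!mulrA.
by rewrite -!normrEsg; ring.
Qed.

(* The l^1 norm of [v] bounds the error term [omega (x - y) v]. *)
Lemma nearby_polar X Y (rho e : R) v :
  (forall x, `|x| <= rho -> X x) -> 0 < rho -> e < rho ->
  (forall x, X x -> exists2 y, Y y & enorm (x - y) <= e) ->
  (forall y, Y y -> omega y v <= 1) ->
  forall x, X x -> omega x v <= rho / (rho - e).
Proof.
move=> Xrho rho0 erho XY Yv; set N := \sum_(i < n + n) `|v 0 i|.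
have N0 : 0 <= N by exact: sumr_ge0.
have Xle x : X x -> omega x v <= 1 + e * N.
  move=> /XY[y /Yv yv xye]; rewrite -(subrK y x) omegaDl addrC; apply: lerD => //.
  by apply: le_trans (omega_le_enorm _ _) _; rewrite ler_wpM2r.
(* At this extremal point [Xle] reads [rho * N <= 1 + e * N], which bounds [N] itself. *)
have [x0 /Xrho/Xle] := omega_sup_ball rho v (ltW rho0).
move=> + x0N; rewrite x0N -/N => rhoN x Xx.
apply: le_trans (Xle x Xx) _.
have e0 : 0 <= e.
  have [y _] := XY x Xx; apply: le_trans; exact: sqrtr_ge0.
have d0 : 0 < rho - e by rewrite subr_gt0.
have N1 : N <= (rho - e)^-1.
  by rewrite -[_^-1]mul1r ler_pdivlMr //; lra.
have -> : rho / (rho - e) = 1 + e * (rho - e)^-1 by field; rewrite gt_eqF.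
by rewrite lerD2l ler_wpM2l.
Qed.

Lemma closed_characteristic_action_ge X Y T gamma (rho e : R) : (0 < n)%N ->
  symplectic_polar X `<=` X -> (forall x, `|x| <= rho -> X x) ->
  0 < rho -> e < rho ->
  (forall x, X x -> exists2 y, Y y & enorm (x - y) <= e) ->
  convex_body Y -> Y° 0 -> closed_characteristic Y T gamma ->
  (1 - e / rho) ^+ 2 * (2 + n%:R^-1) <= action T gamma.
Proof.
move=> n0 polX Xrho rho0 erho XY [cptY cY _] Y0 charg.
have clY : closed Y by apply: compact_closed => //; exact: norm_hausdorff.
rewrite (closed_characteristic_action _ _ _ cY clY Y0 charg).
have [T0 gclosed gcont bg gder] := charg.
have inside t : t \in `]0, T[ -> boundary Y (gamma t).
  by move=> tT; apply: bg; exact: subset_itv_oo_cc tT.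
pose r := rho / (rho - e).
have r0 : 0 < r by rewrite divr_gt0 ?subr_gt0.
have : 4 <= r ^+ 2 * T * ((n + n)%:R / (n + n).+1%:R).
  apply: (closed_curve_length_ge X gamma
    (fun t => J (gradient (gauge_fun Y) (gamma t)))) => //.
  - by move=> t /gder[].
  - move=> t tT; apply: nearby_polar Xrho rho0 erho XY _ => y Yy.
    rewrite omega_J; have [dg _] := gder t tT.
    by apply: dot_gradient_gauge_le1 => //; apply: gauge_boundary => //; exact: inside.
  - move=> t tT; have [dg _] := gder t tT.
    by rewrite omega_J dot_gradient_gauge_self //; exact: inside.
have -> : 1 - e / rho = r^-1.
  by rewrite /r; field; rewrite !gt_eqF ?subr_gt0.
rewrite exprVn ler_pdivrMl ?exprn_gt0 //.
(* For [d = 2n] the factor [d / (d + 1)] equals [2 / (2 + 1 / n)], and [T / 2] is the action. *)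
have -> : r ^+ 2 * T * ((n + n)%:R / (n + n).+1%:R) =
    4 * (r ^+ 2 * (T / 2)) / (2 + n%:R^-1).
  rewrite natrD -natr1 natrD; have : 0 < n%:R :> R by rewrite ltr0n.
  move: (n%:R : R) => N N0; field.
  rewrite !gt_eqF //; lra.
have B0 : 0 < 2 + n%:R^-1 :> R by rewrite addr_gt0 // invr_gt0 ltr0n.
by rewrite ler_pdivlMr // ler_pM2l.
Qed.

End Characteristics.

(** * Passage to the limit along smooth approximations *)

Theorem theorem5p1 (R : realType) (n : nat) (n_gt0 : (0 < n)%N)
    (X : set 'rV[R]_(n + n)) (c : R)
    (bodyX : convex_body X) (symX : centrally_symmetric X)
    (polX : symplectic_polar X `<=` X) (capX : is_cEHZ X c) :
  2 + n%:R^-1 <= c.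
Proof.
have [rho rho0 Xrho] := symmetric_body_ball X bodyX symX.
case: capX => [[Y [a approx]] caplim].
have acvg := caplim Y a approx; have [smoothY minY distY] := approx.
set B := 2 + n%:R^-1.
have B0 : 0 < B by rewrite addr_gt0 // invr_gt0 ltr0n.
have lower s : 0 < s -> s < 1 -> (1 - s) ^+ 2 * B <= c.
  move=> s0 s1; rewrite leNgt; apply/negP => cs.
  have srho : 0 < s * rho by rewrite mulr_gt0.
  have near_dist : \forall k \near \oo, hausdorff_dist (Y k) X < s * rho.
    exact: (cvgr_lt 0 distY).
  have near_a : \forall k \near \oo, a k < (1 - s) ^+ 2 * B.
    exact: (cvgr_lt c acvg).
  have [k [Ydist]] := filter_ex (filterI near_dist near_a).
  rewrite ltNge => /negP; apply.
  have [bodyY Y0 _] := smoothY k.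
  have [[T [gamma [charg <-]]] _] := minY k.
  have [e es XY] := hausdorff_dist_lt _ _ _ bodyX bodyY Ydist.
  have XYs x : X x -> exists2 y, Y k y & enorm (x - y) <= s * rho.
    by move=> /XY[y Yy /le_trans ye]; exists y => //; apply/ye/ltW.
  have -> : s = s * rho / rho by rewrite mulfK // gt_eqF.
  apply: (closed_characteristic_action_ge X (Y k)) => //.
  by rewrite gtr_pMl.
have c0 : 0 <= c.
  apply: le_trans (lower (1 / 2) _ _); [|lra|lra].
  by rewrite mulr_ge0 ?sqr_ge0 ?ltW.
rewrite leNgt -/B; apply/negP => cB.
(* For this [s], [(1 - s) ^+ 2 * B >= B - 2 * s * B = (B + c) / 2 > c], against [lower]. The bound
   [c0] ensures [s < 1]. *)
have s0 : 0 < (B - c) / (4 * B) by rewrite divr_gt0 ?subr_gt0 ?mulr_gt0.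
have s1 : (B - c) / (4 * B) < 1 by rewrite ltr_pdivrMr ?mulr_gt0 //; lra.
have := lower _ s0 s1.
have : (B - c) / (4 * B) * B = (B - c) / 4 by field; rewrite gt_eqF.
move: ((B - c) / (4 * B)) => s sB.
have : 0 <= s ^+ 2 * B by rewrite mulr_ge0 ?sqr_ge0 ?ltW.
rewrite !expr2; lra.
Qed.
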